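(* Let $S$ be a 4-patch surface consisting of $C^1_{\#}$-patches $\mathbf{r}^{(i)}:[0,1]^2\to\mathbb{R}^3$, $i=1,\dots,4$, where adjacent patches share common boundary curves, $$\mathbf{r}^{(1)}(1,v)=\mathbf{r}^{(2)}(0,v),\quad \mathbf{r}^{(4)}(1,v)=\mathbf{r}^{(3)}(0,v),\quad \mathbf{r}^{(1)}(u,1)=\mathbf{r}^{(4)}(u,0),\quad \mathbf{r}^{(2)}(u,1)=\mathbf{r}^{(3)}(u,0)$$ for all $u,v\in[0,1]$, and let $V=\mathbf{r}^{(1)}(1,1)=\mathbf{r}^{(2)}(0,1)=\mathbf{r}^{(3)}(0,0)=\mathbf{r}^{(4)}(1,0)$ be the intersection point of the four patches. Then $S$ is tangent plane continuous ($G^1$) if and only if there exist continuous functions $\lambda_{1,2},\lambda_{1,4},\lambda_{2,3},\lambda_{4,3},\kappa_{1,2},\kappa_{1,4},\kappa_{2,3},\kappa_{4,3}:[0,1]\to\mathbb{R}$ such that for all $u,v\in[0,1]$ $$\begin{aligned} \mathbf{r}^{(2)}_u(0,v)&=\lambda_{1,2}(v)\,\mathbf{r}^{(1)}_u(1,v)+\kappa_{1,2}(v)\,\mathbf{r}^{(1)}_v(1,v),\\ \mathbf{r}^{(3)}_u(0,v)&=\lambda_{4,3}(v)\,\mathbf{r}^{(4)}_u(1,v)+\kappa_{4,3}(v)\,\mathbf{r}^{(4)}_v(1,v),\\ \mathbf{r}^{(4)}_v(u,0)&=\lambda_{1,4}(u)\,\mathbf{r}^{(1)}_v(u,1)+\kappa_{1,4}(u)\,\mathbf{r}^{(1)}_u(u,1),\\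 \mathbf{r}^{(3)}_v(u,0)&=\lambda_{2,3}(u)\,\mathbf{r}^{(2)}_v(u,1)+\kappa_{2,3}(u)\,\mathbf{r}^{(2)}_u(u,1), \end{aligned}$$ and such that the following relations hold at the vertex $V$: $$\begin{aligned} \kappa_{1,2}(1)&=\lambda_{1,4}(1)\,\kappa_{4,3}(0), & \kappa_{1,4}(1)&=\lambda_{1,2}(1)\,\kappa_{2,3}(0),\\ \lambda_{1,2}(1)-\lambda_{4,3}(0)&=\kappa_{1,4}(1)\,\kappa_{4,3}(0), & \lambda_{1,4}(1)-\lambda_{2,3}(0)&=\kappa_{1,2}(1)\,\kappa_{2,3}(0). \end{aligned}$$
   Context: A patch is a map $(u,v)\mapsto\mathbf{r}(u,v)\in\mathbb{R}^3$, $0\le u,v\le1$. It is of class $C^1_{\#}$ if it is continuously differentiable on $[0,1]^2$ and $\mathbf{r}_u\times\mathbf{r}_v\neq0$ for all $0\le u,v\le1$. Subscripts $u,v$ denote partial derivatives. The tangent plane of a patch at a parameter point is $\mathrm{span}\{\mathbf{r}_u,\mathbf{r}_v\}$. A continuous surface is tangent plane continuous ($G^1$) if every point of the surface has a unique tangent plane, which varies continuously on the surface. For a surface composed of $C^1_{\#}$-patches this only has to be checked along the common boundary curves: at each point of a common boundary curve of two adjacent patches (at the corresponding parameter values) the tangent planes (spans of the first partial derivatives) of the two patches must coincide. *)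

(* Defs.v *)
From HB Require Import structures.
From mathcomp Require Import all_boot all_order all_algebra.
From mathcomp Require Import all_classical all_reals all_analysis.
Set Implicit Arguments.
Unset Strict Implicit.
Unset Printing Implicit Defensive.
Import Order.TTheory GRing.Theory Num.Theory.
Import numFieldNormedType.Exports.
Local Open Scope classical_set_scope.
Local Open Scope ring_scope.

(* A patch [0,1]^2 -> R^3 is a total function
   R * R -> 'rV[R]_3 whose values outside the unit square are never used. *)

Definition unit_square (R : realType) : set (R * R) := `[0, 1] `*` `[0, 1].

Definition cross (R : realType) (a b : 'rV[R]_3) : 'rV[R]_3 :=
  \row_(k < 3) [:: a 0 1 * b 0 2 - a 0 2 * b 0 1;
                   a 0 2 * b 0 0 - a 0 0 * b 0 2;
                   a 0 0 * b 0 1 - a 0 1 * b 0 0]`_k.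

(* The increment h is restricted so that the shifted parameter stays in [0,1];
   hence the partial derivatives are one-sided on the edges of the square. *)
Definition increments (R : realType) (t : R) : set_system R :=
  within [set h | 0 <= t + h <= 1] 0^'.

Definition quot_u (R : realType) (r : R * R -> 'rV[R]_3) (p : R * R) (h : R)
    : 'rV[R]_3 :=
  h^-1 *: (r (p.1 + h, p.2) - r p).

Definition quot_v (R : realType) (r : R * R -> 'rV[R]_3) (p : R * R) (h : R)
    : 'rV[R]_3 :=
  h^-1 *: (r (p.1, p.2 + h) - r p).

Definition partial_u (R : realType) (r : R * R -> 'rV[R]_3) (p : R * R)
    : 'rV[R]_3 :=
  lim (quot_u r p @ increments p.1).

Definition partial_v (R : realType) (r : R * R -> 'rV[R]_3) (p : R * R)
    : 'rV[R]_3 :=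
  lim (quot_v r p @ increments p.2).

Definition C1_patch (R : realType) (r : R * R -> 'rV[R]_3) : Prop :=
  [/\ (forall p, unit_square p -> cvg (quot_u r p @ increments p.1)),
      (forall p, unit_square p -> cvg (quot_v r p @ increments p.2)),
      {within @unit_square R, continuous (partial_u r)} &
      {within @unit_square R, continuous (partial_v r)}].

Definition C1sharp_patch (R : realType) (r : R * R -> 'rV[R]_3) : Prop :=
  C1_patch r /\
  forall p, unit_square p -> cross (partial_u r p) (partial_v r p) != 0.

Definition tangent_plane (R : realType) (r : R * R -> 'rV[R]_3) (p : R * R)
    : {vspace 'rV[R]_3} :=
  <<[:: partial_u r p; partial_v r p]>>%VS.

Definition is_orthogonal_projector (R : realType)
    (W : {vspace 'rV[R]_3}) (P : 'M[R]_3) : Prop :=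
  [/\ P^T = P, P *m P = P & forall x : 'rV[R]_3, x \in W <-> x *m P = x].

(* Continuity for the usual topology on the Grassmannian, in which a subspace
   is identified with the orthogonal projector onto it. *)
Definition plane_field_continuous (R : realType) (D : set (R * R))
    (T : R * R -> {vspace 'rV[R]_3}) : Prop :=
  exists2 P : R * R -> 'M[R]_3,
    (forall q, D q -> is_orthogonal_projector (T q) (P q)) &
    {within D, continuous P}.

(* The points of the glued surface are indexed by [0,2]^2, whose four unit
   cells carry the patches, arranged as   r4 r3
                                          r1 r2 .
   A point on a common edge (or the common vertex) belongs to two (or all four)
   cells, and T must be the tangent plane there of every patch concerned.
   Points are indexed by parameters rather than by their position in R^3:
   accidental self-intersections of the surface do not count. *)
Definition tangent_plane_continuous (R : realType)
    (r1 r2 r3 r4 : R * R -> 'rV[R]_3) : Prop :=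
  exists2 T : R * R -> {vspace 'rV[R]_3},
    (forall u v : R, 0 <= u <= 1 -> 0 <= v <= 1 ->
      [/\ T (u, v) = tangent_plane r1 (u, v),
          T (1 + u, v) = tangent_plane r2 (u, v),
          T (1 + u, 1 + v) = tangent_plane r3 (u, v) &
          T (u, 1 + v) = tangent_plane r4 (u, v)]) &
    plane_field_continuous (`[0, 2] `*` `[0, 2]) T.

(* The matching conditions also give
   r1 (1, 1) = r2 (0, 1) = r3 (0, 0) = r4 (1, 0), the vertex of the surface. *)
Definition four_patch_surface (R : realType)
    (r1 r2 r3 r4 : R * R -> 'rV[R]_3) : Prop :=
  [/\ C1sharp_patch r1, C1sharp_patch r2, C1sharp_patch r3 & C1sharp_patch r4]
  /\
  forall u v : R, 0 <= u <= 1 -> 0 <= v <= 1 ->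
    [/\ r1 (1, v) = r2 (0, v), r4 (1, v) = r3 (0, v),
        r1 (u, 1) = r4 (u, 0) & r2 (u, 1) = r3 (u, 0)].

(* Main.v *)
Require Import Defs.
From HB Require Import structures.
From mathcomp Require Import all_boot all_order all_algebra.
From mathcomp Require Import all_classical all_reals all_analysis.
From mathcomp Require Import ring lra.
Set Implicit Arguments.
Unset Strict Implicit.
Unset Printing Implicit Defensive.
Import Order.TTheory GRing.Theory Num.Theory.
Import numFieldNormedType.Exports.
Local Open Scope classical_set_scope.
Local Open Scope ring_scope.


(** A regular patch has the normal vector [n = r_u x r_v], and its tangent
    plane is the orthogonal complement of [n].  The orthogonal projector onto
    that plane is [1 - n^T n / |n|^2], a continuous function of the parameters
    because [n] vanishes nowhere; hence on each patch the plane field is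
    continuous, and by pasting the four closed quarters of the parameter domain
    the whole field is continuous as soon as it is well defined, that is, as
    soon as the planes of adjacent patches agree along the common edges
    ([tangent_plane_continuousP]).

    Adjacent patches share their boundary curve, hence also the derivative [b]
    along it.  Let [a] and [c] be the two derivatives across the edge.  The
    planes spanned by [a, b] and by [c, b] agree if and only if [c] is a
    combination [lam a + kap b]: then [c x b = lam (a x b)], so the two normals
    are proportional.  Conversely Cramer's rule for the frame
    [a, b, a x b] writes [lam] and [kap] as quotients of continuous functions
    with denominator [|a x b|^2], so they are continuous
    ([common_edge_spanP], applied to the four edges).

    The vertex relations are a consequence of the edge relations.  At the
    vertex let [a, b] be the partial derivatives of the first patch, [c] the
    [u]-derivative shared by the second and third patches, and [d] the
    [v]-derivative shared by the third and fourth.  The edge relations express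
    [c] and [d] twice each; comparing coefficients in the basis [a, b] yields
    the four relations ([vertex_relations]). *)

(** * Vector algebra in three dimensions *)

Definition dot (R : realType) (a b : 'rV[R]_3) : R :=
  a 0 0 * b 0 0 + a 0 1 * b 0 1 + a 0 2 * b 0 2.

Lemma row3P (R : realType) (x y : 'rV[R]_3) :
  x 0 0 = y 0 0 -> x 0 1 = y 0 1 -> x 0 2 = y 0 2 -> x = y.
Proof.
move=> e0 e1 e2; apply/rowP => -[[|[|[|//]]] k3].
- by rewrite (_ : Ordinal k3 = 0) //; apply: val_inj.
- by rewrite (_ : Ordinal k3 = 1) //; apply: val_inj.
- by rewrite (_ : Ordinal k3 = 2) //; apply: val_inj.
Qed.

Lemma crossE (R : realType) (a b : 'rV[R]_3) :
  (cross a b 0 0 = a 0 1 * b 0 2 - a 0 2 * b 0 1) *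
  (cross a b 0 1 = a 0 2 * b 0 0 - a 0 0 * b 0 2) *
  (cross a b 0 2 = a 0 0 * b 0 1 - a 0 1 * b 0 0).
Proof. by rewrite /cross !mxE. Qed.

Lemma crossC (R : realType) (a b : 'rV[R]_3) : cross a b = - cross b a.
Proof. by apply: row3P; rewrite !(crossE, mxE); ring. Qed.

Lemma cross_combl (R : realType) (k l : R) (a b : 'rV[R]_3) :
  cross (k *: a + l *: b) b = k *: cross a b.
Proof. by apply: row3P; rewrite !(crossE, mxE); ring. Qed.

Lemma cross_combr (R : realType) (k l : R) (a b : 'rV[R]_3) :
  cross a (k *: a + l *: b) = l *: cross a b.
Proof. by apply: row3P; rewrite !(crossE, mxE); ring. Qed.

Lemma dotC (R : realType) (a b : 'rV[R]_3) : dot a b = dot b a.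
Proof. by rewrite /dot; ring. Qed.

Lemma dotZl (R : realType) (k : R) (a b : 'rV[R]_3) :
  dot (k *: a) b = k * dot a b.
Proof. by rewrite /dot !mxE; ring. Qed.

Lemma dot_eq0 (R : realType) (n : 'rV[R]_3) : (dot n n == 0) = (n == 0).
Proof.
apply/eqP/eqP => [n0|->]; last by rewrite /dot !mxE; ring.
move: n0; rewrite /dot => n0; have := sqr_ge0 (n 0 0).
have := sqr_ge0 (n 0 1); have := sqr_ge0 (n 0 2); rewrite !expr2 => s2 s1 s0.
by apply: row3P; rewrite mxE; apply/eqP; rewrite -[_ == 0]orbb -mulf_eq0;
  apply/eqP; lra.
Qed.

Lemma mulmx_dot (R : realType) (a b : 'rV[R]_3) : a *m b^T = (dot a b)%:M.
Proof.
apply/matrixP => i j; rewrite !ord1 !mxE !big_ord_recl big_ord0 !mxE /dot.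
rewrite addr0 addrA /= mulr1n.
by congr (_ + _ * _ + _ * _); congr (_ _ _); apply: val_inj.
Qed.

(** Cramer's rule in the frame [a], [b], [a x b], with the denominators
    cleared: it holds for all vectors, dependent ones included, and the
    coefficients are polynomial. *)
Lemma frame_decomposition (R : realType) (a b x : 'rV[R]_3) :
  dot (cross a b) (cross a b) *: x =
    dot (cross x b) (cross a b) *: a + dot (cross a x) (cross a b) *: b
    + dot (cross a b) x *: cross a b.
Proof. by apply: row3P; rewrite /dot !(crossE, mxE); ring. Qed.

Lemma frame_coefficients (R : realType) (a b x : 'rV[R]_3) :
  cross a b != 0 -> dot (cross a b) x = 0 ->
  let m := dot (cross a b) (cross a b) in
  x = (m^-1 * dot (cross x b) (cross a b)) *: a
    + (m^-1 * dot (cross a x) (cross a b)) *: b.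
Proof.
rewrite -dot_eq0 => n0 nx m; rewrite -!scalerA -scalerDr.
have := frame_decomposition a b x; rewrite nx scale0r addr0 => <-.
by rewrite scalerA mulVf ?scale1r.
Qed.

(** * Spanned planes and their orthogonal projectors *)

Lemma mem_span_frame (R : realType) (a b x : 'rV[R]_3) : cross a b != 0 ->
  (x \in <<[:: a; b]>>%VS) = (dot (cross a b) x == 0).
Proof.
move=> n0; apply/idP/eqP => [|nx].
  rewrite span_cons span_seq1 => /memv_addP [_ /vlineP[k ->]].
  move=> [_ /vlineP[l ->] ->].
  by rewrite /dot !(crossE, mxE); ring.
rewrite (frame_coefficients n0 nx).
by apply: rpredD; apply: rpredZ; apply: memv_span; rewrite !inE eqxx ?orbT.
Qed.

(** Taking the cross product with [b], or with [a], isolates one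
    coefficient. *)
Lemma frame_inj (R : realType) (a b : 'rV[R]_3) (k l k' l' : R) :
  cross a b != 0 -> k *: a + l *: b = k' *: a + l' *: b -> k = k' /\ l = l'.
Proof.
move=> n0 e; split; apply/eqP; rewrite -subr_eq0.
- have := congr1 (fun x => cross x b) e; rewrite /= !cross_combl => /eqP.
  by rewrite -subr_eq0 -scalerBl scaler_eq0 (negPf n0) orbF.
- have := congr1 (fun x => cross a x) e; rewrite /= !cross_combr => /eqP.
  by rewrite -subr_eq0 -scalerBl scaler_eq0 (negPf n0) orbF.
Qed.

Definition normal_projector (R : realType) (n : 'rV[R]_3) : 'M[R]_3 :=
  1%:M - (dot n n)^-1 *: (n^T *m n).

Lemma normal_projectorP (R : realType) (a b : 'rV[R]_3) : cross a b != 0 ->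
  is_orthogonal_projector <<[:: a; b]>>%VS (normal_projector (cross a b)).
Proof.
move=> n0; have m0 := n0; rewrite -dot_eq0 in m0.
have mulP (x : 'rV[R]_3) n : x *m normal_projector n =
    x - ((dot n n)^-1 * dot x n) *: n.
  rewrite mulmxBr mulmx1 -scalemxAr mulmxA mulmx_dot mul_scalar_mx.
  by rewrite scalerA.
split.
- by rewrite /normal_projector linearB linearZ /= trmx1 trmx_mul trmxK.
- rewrite {1}/normal_projector mulmxBl mul1mx -scalemxAl -mulmxA mulP.
  by rewrite mulVf// scale1r subrr mulmx0 scaler0 subr0.
- move=> x; rewrite mem_span_frame // mulP; split => [/eqP nx|/eqP].
    by rewrite dotC nx mulr0 scale0r subr0.
  rewrite -subr_eq0 addrAC subrr add0r oppr_eq0 scaler_eq0 (negPf n0) orbF.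
  by rewrite mulf_eq0 invr_eq0 (negPf m0) /= dotC.
Qed.

(** Two projectors with the same image absorb each other, [P Q = P] and
    [Q P = Q]; transposing the first identity turns it into [Q P = P]. *)
Lemma orthogonal_projector_unique (R : realType) (W : {vspace 'rV[R]_3})
    (P Q : 'M[R]_3) :
  is_orthogonal_projector W P -> is_orthogonal_projector W Q -> P = Q.
Proof.
have absorb A B : is_orthogonal_projector W A -> is_orthogonal_projector W B ->
    A *m B = A.
  move=> [_ AA WA] [_ _ WB]; apply/row_matrixP => i.
  by rewrite row_mul; apply/WB/WA; rewrite -row_mul AA.
move=> hP hQ; have [tP _ _] := hP; have [tQ _ _] := hQ.
by rewrite -tP -[in LHS](absorb _ _ hP hQ) trmx_mul tP tQ absorb.
Qed.

(** * Limits of vectors and projectors *)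

Lemma cvg_coord (R : realType) (T : Type) (F : set_system T) (FF : Filter F)
    (m n : nat) (f : T -> 'M[R]_(m, n)) (M : 'M[R]_(m, n)) :
  (forall i j, f x i j @[x --> F] --> M i j) -> f @ F --> M.
Proof.
move=> fM A [P MP PA]; rewrite /nbhs /= /fmap /=.
apply: (@filterS _ F _ [set x | forall i j, P i j (f x i j)]).
  by move=> x /= Px; exact: PA.
apply: filter_forall => i; apply: filter_forall => j.
exact: (fM i j).
Qed.

Lemma coord_cvg (R : realType) (T : Type) (F : set_system T) (FF : Filter F)
    (m n : nat) (f : T -> 'M[R]_(m, n)) (M : 'M[R]_(m, n)) i j :
  f @ F --> M -> f x i j @[x --> F] --> M i j.
Proof.
move=> fM; have /= := @coord_continuous R m n i j M.
exact: (@cvg_comp _ _ _ f (fun A : 'M[R]_(m, n) => A i j) F (nbhs M)).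
Qed.

Lemma cvg_dot (R : realType) (T : Type) (F : set_system T) (FF : Filter F)
    (f g : T -> 'rV[R]_3) (a b : 'rV[R]_3) :
  f @ F --> a -> g @ F --> b -> dot (f x) (g x) @[x --> F] --> dot a b.
Proof.
move=> fa gb.
by apply: cvgD; [apply: cvgD|]; apply: cvgM; apply: coord_cvg.
Qed.

Lemma cvg_cross (R : realType) (T : Type) (F : set_system T) (FF : Filter F)
    (f g : T -> 'rV[R]_3) (a b : 'rV[R]_3) :
  f @ F --> a -> g @ F --> b -> cross (f x) (g x) @[x --> F] --> cross a b.
Proof.
move=> fa gb; apply: cvg_coord => i k; rewrite !ord1 /cross.
under eq_cvg do rewrite mxE.
rewrite mxE; case: k => -[|[|[|//]]] _ /=; apply: cvgB; apply: cvgM;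
  exact: coord_cvg.
Qed.

Lemma cvg_normal_projector (R : realType) (T : Type) (F : set_system T)
    (FF : Filter F) (f : T -> 'rV[R]_3) (a : 'rV[R]_3) :
  f @ F --> a -> a != 0 ->
  normal_projector (f x) @[x --> F] --> normal_projector a.
Proof.
move=> fa a0; apply: cvg_coord => i j; rewrite /normal_projector.
under eq_cvg do rewrite !mxE big_ord1 !mxE.
rewrite !mxE big_ord1 !mxE; apply: cvgB; first exact: cvg_cst.
apply: cvgM; last by apply: cvgM; exact: coord_cvg.
by apply: cvgV; [rewrite dot_eq0|exact: cvg_dot].
Qed.

(** * Planes along a curve with a shared direction *)

Lemma within_continuous_precomp (X Y Z : topologicalType) (A : set X)
    (B : set Y) (h : X -> Y) (f : Y -> Z) :
  continuous h -> (forall x, A x -> B (h x)) ->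
  {within B, continuous f} -> {within A, continuous (f \o h)}.
Proof.
move=> hc hAB /subspace_continuousP fc; apply/subspace_continuousP => x Ax.
move=> W /(fc _ (hAB _ Ax)) BW.
apply: (@filterS _ (nbhs x) _ _ _ _ (hc x _ BW)) => y /= fW Ay.
exact/fW/hAB.
Qed.

Lemma span_pairC (R : realType) (a b : 'rV[R]_3) :
  (<<[:: a; b]>> = <<[:: b; a]>>)%VS.
Proof. by rewrite !span_cons !span_nil !addv0 addvC. Qed.

(** Here [b] is the derivative along a common edge and [a], [c] are the
    derivatives of the two patches across it.  If the planes agree, [c] is
    orthogonal to [a x b] and Cramer's rule gives continuous coefficients.  If
    [c] is a combination of [a] and [b], the normals satisfy
    [c x b = lam (a x b)], where [lam] is nonzero because [c x b] is. *)
Lemma common_edge_spanP (R : realType) (D : set R) (a b c : R -> 'rV[R]_3) :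
  {within D, continuous a} -> {within D, continuous b} ->
  {within D, continuous c} ->
  (forall t, D t -> cross (a t) (b t) != 0) ->
  (forall t, D t -> cross (c t) (b t) != 0) ->
  (forall t, D t -> <<[:: a t; b t]>>%VS = <<[:: c t; b t]>>%VS) <->
  exists lam kap : R -> R, [/\ {within D, continuous lam},
    {within D, continuous kap} &
    forall t, D t -> c t = lam t *: a t + kap t *: b t].
Proof.
move=> /subspace_continuousP ca /subspace_continuousP cb.
move=> /subspace_continuousP cc ab0 cb0; split => [same_span|].
  pose n t := cross (a t) (b t).
  exists (fun t => (dot (n t) (n t))^-1 * dot (cross (c t) (b t)) (n t)).
  exists (fun t => (dot (n t) (n t))^-1 * dot (cross (a t) (c t)) (n t)).
  have cn t (Dt : D t) : n s @[s --> within D (nbhs t)] --> n t.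
    by apply: cvg_cross; [exact: ca|exact: cb].
  have cV t (Dt : D t) :
      (dot (n s) (n s))^-1 @[s --> within D (nbhs t)] --> (dot (n t) (n t))^-1.
    by apply: cvgV; [rewrite dot_eq0 ab0|apply: cvg_dot; exact: cn].
  split.
  - apply/subspace_continuousP => t Dt; apply: cvgM; first exact: cV.
    apply: cvg_dot; last exact: cn.
    by apply: cvg_cross; [exact: cc|exact: cb].
  - apply/subspace_continuousP => t Dt; apply: cvgM; first exact: cV.
    apply: cvg_dot; last exact: cn.
    by apply: cvg_cross; [exact: ca|exact: cc].
  - move=> t Dt; apply: frame_coefficients; first exact: ab0.
    apply/eqP; rewrite -mem_span_frame ?ab0// same_span//.
    by apply: memv_span; rewrite mem_head.
move=> [lam [kap [_ _ cE]]] t Dt; apply/vspaceP => x.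
rewrite !mem_span_frame ?ab0 ?cb0//.
have := cb0 t Dt; rewrite cE// cross_combl scaler_eq0 negb_or => /andP[l0 _].
by rewrite dotZl mulf_eq0 (negPf l0).
Qed.

(** * Partial derivatives along shared edges *)

Lemma lim_eq_within (T : Type) (V : ptopologicalType) (F : set_system T)
    (A : set T) (f g : T -> V) :
  (forall t, A t -> f t = g t) ->
  lim (f @ within A F) = lim (g @ within A F).
Proof.
move=> fg; suff -> : f @ within A F = g @ within A F by [].
apply/funext => W; congr (F _); apply/funext => t; apply/propext.
by split=> /= + At => /(_ At); rewrite fg.
Qed.

(** The difference quotients only use values of the patch on the edge itself,
    because the increments stay inside the unit interval. *)
Lemma partial_u_edge (R : realType) (r r' : R * R -> 'rV[R]_3) (x y y' : R) :
  (forall s, 0 <= s <= 1 -> r (s, y) = r' (s, y')) -> 0 <= x <= 1 ->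
  partial_u r (x, y) = partial_u r' (x, y').
Proof.
move=> rr' x01; apply: lim_eq_within => h /= xh.
by rewrite /quot_u /= !rr'.
Qed.

Lemma partial_v_edge (R : realType) (r r' : R * R -> 'rV[R]_3) (x x' y : R) :
  (forall s, 0 <= s <= 1 -> r (x, s) = r' (x', s)) -> 0 <= y <= 1 ->
  partial_v r (x, y) = partial_v r' (x', y).
Proof.
move=> rr' y01; apply: lim_eq_within => h /= yh.
by rewrite /quot_v /= !rr'.
Qed.

(** * The plane field of a surface made of four patches *)

Lemma unit_squareP (R : realType) (u v : R) :
  unit_square (u, v) <-> 0 <= u <= 1 /\ 0 <= v <= 1.
Proof. by rewrite /unit_square /setX /= !in_itv. Qed.

Definition normal (R : realType) (r : R * R -> 'rV[R]_3) (p : R * R) :=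
  cross (partial_u r p) (partial_v r p).

Lemma tangent_plane_projector (R : realType) (r : R * R -> 'rV[R]_3)
    (p : R * R) : C1sharp_patch r -> unit_square p ->
  is_orthogonal_projector (tangent_plane r p) (normal_projector (normal r p)).
Proof. by move=> rC Sp; apply: normal_projectorP; exact: rC.2. Qed.

Lemma normal_projector_continuous (R : realType) (r : R * R -> 'rV[R]_3) :
  C1sharp_patch r ->
  {within @unit_square R, continuous
    (fun p => normal_projector (normal r p))}.
Proof.
move=> [[_ _ /subspace_continuousP cu /subspace_continuousP cv] n0].
apply/subspace_continuousP => p Sp.
apply: cvg_normal_projector; last exact: n0.
by apply: cvg_cross; [exact: cu|exact: cv].
Qed.

Lemma square_closed (R : realType) (a b c d : R) :
  closed (`[a, b] `*` `[c, d] : set (R * R)).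
Proof.
rewrite (_ : _ `*` _ = fst @^-1` `[a, b] `&` snd @^-1` `[c, d])//.
by apply: closedI; apply: preimage_closed; try exact: interval_closed;
  move=> p _; [exact: cvg_fst|exact: cvg_snd].
Qed.

Lemma square_quarters (R : realType) :
  `[0, 2] `*` `[0, 2] =
  (`[0, 1] `*` `[0, 1] `|` `[1, 2] `*` `[0, 1]) `|`
  (`[1, 2] `*` `[1, 2] `|` `[0, 1] `*` `[1, 2]) :> set (R * R).
Proof.
apply/seteqP; split => [[x y]|[x y]]; rewrite /setX /setU /= !in_itv /=.
  move=> [/andP[x0 x2] /andP[y0 y2]].
  case: (leP x 1) => x1; case: (leP y 1) => y1.
  - by left; left; rewrite x0 y0.
  - by right; right; rewrite x0 y2 (ltW y1).
  - by left; right; rewrite x2 y0 (ltW x1).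
  - by right; left; rewrite x2 y2 (ltW x1) (ltW y1).
by move=> [[]|[]] [/andP[? ?] /andP[? ?]]; split; lra.
Qed.

(** [A] is the cell of a patch in the parameter domain of the whole surface and
    [h] moves it back onto the unit square.  By uniqueness of orthogonal
    projectors, [P] has to be the explicit one, which is continuous. *)
Lemma plane_projector_continuous (R : realType) (r : R * R -> 'rV[R]_3)
    (T : R * R -> {vspace 'rV[R]_3}) (P : R * R -> 'M[R]_3)
    (A : set (R * R)) (h : R * R -> R * R) :
  C1sharp_patch r -> continuous h -> (forall q, A q -> unit_square (h q)) ->
  (forall q, A q -> T q = tangent_plane r (h q)) ->
  (forall q, A q -> is_orthogonal_projector (T q) (P q)) ->
  {within A, continuous P}.
Proof.
move=> rC hc hA Tr TP; apply: (@subspace_eq_continuous _ A _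
  (fun q => normal_projector (normal r (h q)))).
  move=> q /set_mem Aq; apply: (orthogonal_projector_unique _ (TP q Aq)).
  by rewrite Tr//; apply: tangent_plane_projector => //; exact: hA.
exact: within_continuous_precomp hc hA (normal_projector_continuous rC).
Qed.

Lemma shift_continuous (R : realType) (i j : R) :
  continuous (fun q : R * R => (q.1 - i, q.2 - j)).
Proof.
move=> q.
have c1 : p.1 - i @[p --> q] --> q.1 - i.
  by apply: cvgB; [exact: cvg_fst|exact: cvg_cst].
have c2 : p.2 - j @[p --> q] --> q.2 - j.
  by apply: cvgB; [exact: cvg_snd|exact: cvg_cst].
exact: (cvg_pair c1 c2).
Qed.

(** Gluing four regular patches: agreement of the planes along the common edges
    already forces continuity of the whole plane field. *)
Lemma tangent_plane_continuousP (R : realType)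
    (r1 r2 r3 r4 : R * R -> 'rV[R]_3) :
  C1sharp_patch r1 -> C1sharp_patch r2 -> C1sharp_patch r3 ->
  C1sharp_patch r4 ->
  tangent_plane_continuous r1 r2 r3 r4 <->
  (forall t : R, 0 <= t <= 1 ->
    [/\ tangent_plane r1 (1, t) = tangent_plane r2 (0, t),
        tangent_plane r4 (1, t) = tangent_plane r3 (0, t),
        tangent_plane r1 (t, 1) = tangent_plane r4 (t, 0) &
        tangent_plane r2 (t, 1) = tangent_plane r3 (t, 0)]).
Proof.
move=> r1C r2C r3C r4C.
have i0 : 0 <= (0 : R) <= 1 by rewrite !lexx ler01.
have i1 : 0 <= (1 : R) <= 1 by rewrite !lexx ler01.
split=> [[T Tr _] t t01|edges].
  have [_ T2 T3 _] := Tr 0 t i0 t01; have [T1 _ _ T4] := Tr 1 t i1 t01.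
  have [_ _ T3' T4'] := Tr t 0 t01 i0; have [T1' T2' _ _] := Tr t 1 t01 i1.
  move: T2 T3 T3' T4'; rewrite !addr0 => T2 T3 T3' T4'.
  by split;
    [rewrite -T1 -T2|rewrite -T4 -T3|rewrite -T1' -T4'|rewrite -T2' -T3'].
pose T (q : R * R) := let: (x, y) := q in
  if x <= 1 then if y <= 1 then tangent_plane r1 (x, y)
                 else tangent_plane r4 (x, y - 1)
  else if y <= 1 then tangent_plane r2 (x - 1, y)
       else tangent_plane r3 (x - 1, y - 1).
have Tr u v : 0 <= u <= 1 -> 0 <= v <= 1 ->
    [/\ T (u, v) = tangent_plane r1 (u, v),
        T (1 + u, v) = tangent_plane r2 (u, v),
        T (1 + u, 1 + v) = tangent_plane r3 (u, v) &
        T (u, 1 + v) = tangent_plane r4 (u, v)].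
  move=> u01 v01; have [E12 E43 _ _] := edges v v01.
  have [_ _ E14 E23] := edges u u01.
  have [_ _ _ E23'] := edges 0 i0; have [E12' _ _ _] := edges 1 i1.
  move: (u01) (v01) => /andP[u0 u1] /andP[v0 v1].
  have split0 (s : R) : 0 <= s -> (1 + s <= 1) = (s == 0).
    by move=> s0; rewrite gerDl eq_le s0 andbT.
  rewrite /T u1 v1 !split0// ![1 + _]addrC !addrK.
  split=> //.
  - by case: eqP => [->|//]; rewrite add0r.
  (* For the third patch both edges and the vertex matter: at the vertex the
     plane of the first patch is compared with that of the third through the
     second. *)
  - case: eqP => [u_0|_]; case: eqP => [v_0|_] //; rewrite ?u_0 ?v_0 ?add0r.
    + by rewrite E12' E23'.
    + by rewrite E43.
    + by rewrite E23.
  - by case: eqP => [->|//]; rewrite add0r.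
(* Choosing the projector of T q, rather than defining it by cases, spares a
   second comparison on the overlaps of the cells. *)
pose P q := xget 0 (is_orthogonal_projector (T q)).
have quarter i j r : C1sharp_patch r ->
    (forall u v, 0 <= u <= 1 -> 0 <= v <= 1 ->
      T (i + u, j + v) = tangent_plane r (u, v)) ->
    {within `[i, i + 1] `*` `[j, j + 1], continuous P} /\
    (forall q, (`[i, i + 1] `*` `[j, j + 1]) q ->
      is_orthogonal_projector (T q) (P q)).
  move=> rC Trij; pose h (q : R * R) := (q.1 - i, q.2 - j).
  have hA q : (`[i, i + 1] `*` `[j, j + 1]) q -> unit_square (h q).
    case: q => x y; rewrite /setX /= !in_itv/= => -[? ?].
    by rewrite /h /=; apply/unit_squareP; split; lra.
  have Th q : (`[i, i + 1] `*` `[j, j + 1]) q -> T q = tangent_plane r (h q).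
    move=> /hA; case: q => x y /unit_squareP[hx hy].
    by rewrite -Trij// ![_ + (_ - _)]addrC !subrK.
  have TP q : (`[i, i + 1] `*` `[j, j + 1]) q ->
      is_orthogonal_projector (T q) (P q).
    move=> Aq; apply: (xgetPex 0); exists (normal_projector (normal r (h q))).
    by rewrite Th//; apply: tangent_plane_projector => //; exact: hA.
  split=> //; exact: plane_projector_continuous rC (@shift_continuous R i j)
    hA Th TP.
have [c1 P1] := quarter 0 0 r1 r1C (fun u v hu hv =>
  let: And4 h _ _ _ := Tr u v hu hv in ltac:(by rewrite !add0r)).
have [c2 P2] := quarter 1 0 r2 r2C (fun u v hu hv =>
  let: And4 _ h _ _ := Tr u v hu hv in ltac:(by rewrite add0r)).
have [c3 P3] := quarter 1 1 r3 r3C (fun u v hu hv =>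
  let: And4 _ _ h _ := Tr u v hu hv in h).
have [c4 P4] := quarter 0 1 r4 r4C (fun u v hu hv =>
  let: And4 _ _ _ h := Tr u v hu hv in ltac:(by rewrite add0r)).
rewrite !add0r in c1 P1 c2 P2 c4 P4.
exists T => //; exists P; rewrite square_quarters (_ : 2 = 1 + 1)//.
  by move=> q [[|]|[|]]; [exact: P1|exact: P2|exact: P3|exact: P4].
by apply: withinU_continuous; try (apply: closedU; exact: square_closed);
  apply: withinU_continuous => //; exact: square_closed.
Qed.

(** [c] and [d] are the two derivatives at the vertex belonging to the edges
    that do not lie on the first patch, each expressed in two ways.
    Substituting the first pair of equations into the second and comparing
    coefficients in the basis [a], [b] gives all four relations. *)
Lemma vertex_relations (R : realType) (a b c d : 'rV[R]_3)
    (l12 k12 l14 k14 l23 k23 l43 k43 : R) :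
  cross a b != 0 ->
  c = l12 *: a + k12 *: b -> d = l14 *: b + k14 *: a ->
  c = l43 *: a + k43 *: d -> d = l23 *: b + k23 *: c ->
  [/\ k12 = l14 * k43, k14 = l12 * k23, l12 - l43 = k14 * k43 &
      l14 - l23 = k12 * k23].
Proof.
move=> n0 cE dE cE' dE'.
have [|e1 e2] := @frame_inj R a b l12 k12 (l43 + k43 * k14) (k43 * l14) n0.
  by rewrite -cE cE' dE !(scalerDr, scalerDl) !scalerA addrA addrAC.
have [|e3 e4] := @frame_inj R a b k14 l14 (k23 * l12) (l23 + k23 * k12) n0.
  rewrite addrC -dE dE' cE !(scalerDr, scalerDl) !scalerA.
  by rewrite [LHS]addrC -addrA [X in _ + X]addrC.
by split; lra.
Qed.

(** * Edge conditions for adjacent patches *)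

Lemma inI01 (R : realType) (t : R) : `[0, 1]%classic t <-> 0 <= t <= 1.
Proof. by rewrite /= in_itv. Qed.

Lemma edge_frame_continuous (R : realType) (f : R * R -> 'rV[R]_3) (s : R) :
  {within @unit_square R, continuous f} -> 0 <= s <= 1 ->
  {within `[0, 1], continuous (fun t => f (s, t))} /\
  {within `[0, 1], continuous (fun t => f (t, s))}.
Proof.
move=> fc s01; split.
- have hc : continuous (fun t : R => (s, t)).
    by move=> t; apply: (cvg_pair (cvg_cst s) cvg_id).
  have hA t : `[0, 1]%classic t -> unit_square (s, t).
    by move=> /inI01 t01; apply/unit_squareP.
  exact: (within_continuous_precomp hc hA fc).
- have hc : continuous (fun t : R => (t, s)).
    by move=> t; apply: (cvg_pair cvg_id (cvg_cst s)).
  have hA t : `[0, 1]%classic t -> unit_square (t, s).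
    by move=> /inI01 t01; apply/unit_squareP.
  exact: (within_continuous_precomp hc hA fc).
Qed.

Lemma vertical_edgeP (R : realType) (r r' : R * R -> 'rV[R]_3) :
  C1sharp_patch r -> C1sharp_patch r' ->
  (forall v : R, 0 <= v <= 1 -> r (1, v) = r' (0, v)) ->
  (forall v : R, 0 <= v <= 1 ->
    tangent_plane r (1, v) = tangent_plane r' (0, v))
  <-> exists lam kap : R -> R,
    [/\ {within `[0, 1], continuous lam}, {within `[0, 1], continuous kap} &
      forall v : R, 0 <= v <= 1 -> partial_u r' (0, v) =
        lam v *: partial_u r (1, v) + kap v *: partial_v r (1, v)].
Proof.
move=> [[_ _ cu cv] n0] [[_ _ cu' _] n0'] shared.
have i0 : 0 <= (0 : R) <= 1 by rewrite !lexx ler01.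
have i1 : 0 <= (1 : R) <= 1 by rewrite !lexx ler01.
have vv v : 0 <= v <= 1 -> partial_v r (1, v) = partial_v r' (0, v).
  exact: partial_v_edge.
have [||edge_coef coef_edge] := common_edge_spanP
  (edge_frame_continuous cu i1).1
  (edge_frame_continuous cv i1).1 (edge_frame_continuous cu' i0).1.
- by move=> v /inI01 v01; apply/n0/unit_squareP.
- by move=> v /inI01 v01; rewrite vv//; apply/n0'/unit_squareP.
split=> [same_plane|[lam [kap [lc kc E]]] v v01].
- have [|lam [kap [lc kc E]]] := edge_coef.
    move=> v /inI01 v01; have := same_plane v v01.
    by rewrite /tangent_plane -vv.
  by exists lam, kap; split=> // v /inI01; exact: E.
- rewrite /tangent_plane -vv//; apply: coef_edge; last exact/inI01.
  by exists lam, kap; split=> // w /inI01; exact: E.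
Qed.

(** The roles of [u] and [v] are exchanged with respect to a vertical edge, so
    the frame is reversed and the cross product changes sign. *)
Lemma horizontal_edgeP (R : realType) (r r' : R * R -> 'rV[R]_3) :
  C1sharp_patch r -> C1sharp_patch r' ->
  (forall u : R, 0 <= u <= 1 -> r (u, 1) = r' (u, 0)) ->
  (forall u : R, 0 <= u <= 1 ->
    tangent_plane r (u, 1) = tangent_plane r' (u, 0))
  <-> exists lam kap : R -> R,
    [/\ {within `[0, 1], continuous lam}, {within `[0, 1], continuous kap} &
      forall u : R, 0 <= u <= 1 -> partial_v r' (u, 0) =
        lam u *: partial_v r (u, 1) + kap u *: partial_u r (u, 1)].
Proof.
move=> [[_ _ cu cv] n0] [[_ _ _ cv'] n0'] shared.
have i0 : 0 <= (0 : R) <= 1 by rewrite !lexx ler01.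
have i1 : 0 <= (1 : R) <= 1 by rewrite !lexx ler01.
have uu u : 0 <= u <= 1 -> partial_u r (u, 1) = partial_u r' (u, 0).
  exact: partial_u_edge.
have [||edge_coef coef_edge] := common_edge_spanP
  (edge_frame_continuous cv i1).2
  (edge_frame_continuous cu i1).2 (edge_frame_continuous cv' i0).2.
- by move=> u /inI01 u01; rewrite crossC oppr_eq0; apply/n0/unit_squareP.
- move=> u /inI01 u01; rewrite crossC oppr_eq0 uu//.
  by apply/n0'/unit_squareP.
split=> [same_plane|[lam [kap [lc kc E]]] u u01].
- have [|lam [kap [lc kc E]]] := edge_coef.
    move=> u /inI01 u01; have := same_plane u u01.
    by rewrite /tangent_plane -uu// span_pairC => ->; rewrite span_pairC.
  by exists lam, kap; split=> // u /inI01; exact: E.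
- rewrite /tangent_plane -uu// span_pairC [RHS]span_pairC.
  apply: coef_edge; last exact/inI01.
  by exists lam, kap; split=> // w /inI01; exact: E.
Qed.

Theorem theorem1 (R : realType) (r1 r2 r3 r4 : R * R -> 'rV[R]_3)
    (hS : four_patch_surface r1 r2 r3 r4) :
  tangent_plane_continuous r1 r2 r3 r4 <->
  exists lam12 lam14 lam23 lam43 kap12 kap14 kap23 kap43 : R -> R,
    [/\ [/\ {within `[0, 1], continuous lam12},
            {within `[0, 1], continuous lam14},
            {within `[0, 1], continuous lam23} &
            {within `[0, 1], continuous lam43}],
        [/\ {within `[0, 1], continuous kap12},
            {within `[0, 1], continuous kap14},
            {within `[0, 1], continuous kap23} &
            {within `[0, 1], continuous kap43}],
        (forall u v : R, 0 <= u <= 1 -> 0 <= v <= 1 ->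
          [/\ partial_u r2 (0, v) = lam12 v *: partial_u r1 (1, v)
                                  + kap12 v *: partial_v r1 (1, v),
              partial_u r3 (0, v) = lam43 v *: partial_u r4 (1, v)
                                  + kap43 v *: partial_v r4 (1, v),
              partial_v r4 (u, 0) = lam14 u *: partial_v r1 (u, 1)
                                  + kap14 u *: partial_u r1 (u, 1) &
              partial_v r3 (u, 0) = lam23 u *: partial_v r2 (u, 1)
                                  + kap23 u *: partial_u r2 (u, 1)]) &
        [/\ kap12 1 = lam14 1 * kap43 0,
            kap14 1 = lam12 1 * kap23 0,
            lam12 1 - lam43 0 = kap14 1 * kap43 0 &
            lam14 1 - lam23 0 = kap12 1 * kap23 0]].
Proof.
have [[r1C r2C r3C r4C] shared] := hS.
have i0 : 0 <= (0 : R) <= 1 by rewrite !lexx ler01.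
have i1 : 0 <= (1 : R) <= 1 by rewrite !lexx ler01.
have s12 (v : R) (hv : 0 <= v <= 1) : r1 (1, v) = r2 (0, v)
  by case: (shared 0 v).
have s43 (v : R) (hv : 0 <= v <= 1) : r4 (1, v) = r3 (0, v)
  by case: (shared 0 v).
have s14 (u : R) (hu : 0 <= u <= 1) : r1 (u, 1) = r4 (u, 0)
  by case: (shared u 0).
have s23 (u : R) (hu : 0 <= u <= 1) : r2 (u, 1) = r3 (u, 0)
  by case: (shared u 0).
have G1P := tangent_plane_continuousP r1C r2C r3C r4C.
have E12 := vertical_edgeP r1C r2C s12; have E43 := vertical_edgeP r4C r3C s43.
have E14 := horizontal_edgeP r1C r4C s14.
have E23 := horizontal_edgeP r2C r3C s23.
split=> [/G1P edges|].
- have [t t01|lam12 [kap12 [cl12 ck12 e12]]] := E12.1; first by case: (edges t).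
  have [t t01|lam43 [kap43 [cl43 ck43 e43]]] := E43.1; first by case: (edges t).
  have [t t01|lam14 [kap14 [cl14 ck14 e14]]] := E14.1; first by case: (edges t).
  have [t t01|lam23 [kap23 [cl23 ck23 e23]]] := E23.1; first by case: (edges t).
  exists lam12, lam14, lam23, lam43, kap12, kap14, kap23, kap43; split => //.
    by move=> u v u01 v01; split; [exact: e12|exact: e43|exact: e14|exact: e23].
  (* At its corner (0, 0) the third patch has the partial derivatives c and d,
     by the curves shared with the second and fourth patches.  Its two edge
     relations express them through derivatives of these patches; the ones
     along edges of the first patch are a and b. *)
  apply: (@vertex_relations R (partial_u r1 (1, 1)) (partial_v r1 (1, 1))
    (partial_u r2 (0, 1)) (partial_v r4 (1, 0))).
  + by apply: r1C.2; exact/unit_squareP.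
  + exact: e12.
  + exact: e14.
  + rewrite (partial_u_edge s23 i0) (partial_u_edge s14 i1); exact: e43.
  + rewrite (partial_v_edge s43 i0) (partial_v_edge s12 i1); exact: e23.
- move=> [lam12 [lam14 [lam23 [lam43 [kap12 [kap14 [kap23 [kap43]]]]]]]].
  move=> [[cl12 cl14 cl23 cl43] [ck12 ck14 ck23 ck43] e _].
  apply/G1P => t t01; split.
  + apply: E12.2 => //; exists lam12, kap12; split => // v v01.
    by case: (e 0 v).
  + apply: E43.2 => //; exists lam43, kap43; split => // v v01.
    by case: (e 0 v).
  + apply: E14.2 => //; exists lam14, kap14; split => // u u01.
    by case: (e u 0).
  + apply: E23.2 => //; exists lam23, kap23; split => // u u01.
    by case: (e u 0).
Qed.
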